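(* Let $(A,\cdot,\bullet)$ be a two-sided skew brace with associative $\star$-product. Then for every $n\geq 1$, \[L_n=Q_n=S_n=P_n(A).\] In particular, left, right and strong $\star$-nilpotence of $A$ are equivalent.
   Context: A skew brace is a triple $(A,\cdot,\bullet)$ where $A^{\cdot}=(A,\cdot)$ and $A^{\bullet}=(A,\bullet)$ are groups with the same identity $1$ such that $a\bullet(b\cdot c)=(a\bullet b)\cdot a^{-1}\cdot(a\bullet c)$ for all $a,b,c\in A$, where $a^{-1}$ is the inverse in $A^{\cdot}$. It is two-sided if in addition $(a\cdot b)\bullet c=(a\bullet c)\cdot c^{-1}\cdot(b\bullet c)$ for all $a,b,c$. The $\star$-product is $a\star b:=a^{-1}\cdot(a\bullet b)\cdot b^{-1}$. For subsets $X,Y\subseteq A$, $X\star Y$ is the subgroup of $A^{\cdot}$ generated by all $x\star y$ with $x\in X$, $y\in Y$. For associative $\star$, set $P_1(A):=A$ and, for $n\geq 2$, let $P_n(A)$ be the subgroup of $A^{\cdot}$ generated by all products $a_1\star\cdots\star a_n$ with $a_i\in A$. The left, right and strong $\star$-series are defined by $L_1=Q_1=S_1=A$ and, for $n\geq 1$, $L_{n+1}=A\star L_n$, $Q_{n+1}=Q_n\star A$, and $S_{n+1}$ is the subgroup of $A^{\cdot}$ generated by $S_i\star S_{n+1-i}$ for $1\leq i\leq n$. $A$ is left (resp. right, strongly) $\star$-nilpotent if $L_n=\{1\}$ (resp. $Q_n=\{1\}$, $S_n=\{1\}$) for some $n$. *)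

(* Defs.v *)
From HB Require Import structures.
From mathcomp Require Import all_boot.
From mathcomp Require Import boolp classical_sets.

Set Implicit Arguments.
Unset Strict Implicit.
Unset Printing Implicit Defensive.

Local Open Scope classical_set_scope.
Local Open Scope group_scope.

Reserved Notation "x \bullet y" (at level 40, left associativity).
Reserved Notation "x \star y" (at level 40, left associativity).
Reserved Notation "X \sstar Y" (at level 40, left associativity).

(* The canonical [groupType] structure of a skew brace is its dot group,
   written [x * y], [x^-1]; [bul] and [bulV] are the product and the inverse
   of the bullet group, which shares the identity [1]. *)
HB.mixin Record Group_isSkewBrace A of Group A := {
  bul : A -> A -> A;
  bulV : A -> A;
  bulA : associative bul;
  bul1x : left_id (1 : A) bul;
  bulx1 : right_id (1 : A) bul;
  bulVx : left_inverse (1 : A) bulV bul;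
  bulxV : right_inverse (1 : A) bulV bul;
  bulMr : forall a b c : A, bul a (b * c) = bul a b * a^-1 * bul a c
}.

#[short(type="skewBraceType")]
HB.structure Definition SkewBrace := {A of Group_isSkewBrace A & Group A}.

Notation "x \bullet y" := (bul x y) : group_scope.

Definition two_sided (A : skewBraceType) : Prop :=
  forall a b c : A,
    (a * b) \bullet c = (a \bullet c) * c^-1 * (b \bullet c).

Definition star (A : skewBraceType) (a b : A) : A :=
  a^-1 * (a \bullet b) * b^-1.

Notation "x \star y" := (star x y) : group_scope.

Definition gen_subgroup (G : groupType) (X : set G) : set G :=
  smallest (fun H : set G => group_closed (mem H)) X.

Definition set_star (A : skewBraceType) (X Y : set A) : set A :=
  gen_subgroup [set x \star y | x in X & y in Y].

Notation "X \sstar Y" := (set_star X Y) : classical_set_scope.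

Section Series.
Variable A : skewBraceType.

(* All the sequences below start at index 1; their value at 0 is a dummy. *)

(* The products are bracketed to the left, which is immaterial when the star
   product is associative. *)
Definition star_power (n : nat) : set A :=
  match n with
  | n'.+2 => gen_subgroup
      [set foldl (@star A) a (s : seq A) | a in [set: A]
                                         & s in [set: n'.+1.-tuple A]]
  | _ => [set: A]
  end.

Fixpoint left_series (n : nat) : set A :=
  match n with
  | (n'.+1 as m).+1 => [set: A] \sstar left_series m
  | _ => [set: A]
  end.

Fixpoint right_series (n : nat) : set A :=
  match n with
  | (n'.+1 as m).+1 => right_series m \sstar [set: A]
  | _ => [set: A]
  end.

(* [strong_series_rec d k] is the k-th term, computed with recursion depth d;
   it does not depend on d as soon as [k <= d]. The defining recurrence is
   [strong_seriesS] below. *)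
Fixpoint strong_series_rec (d k : nat) : set A :=
  match d with
  | 0 => [set: A]
  | d'.+1 =>
      if k <= 1 then [set: A]
      else gen_subgroup (\bigcup_(i in [set i | 1 <= i < k])
             (strong_series_rec d' i \sstar strong_series_rec d' (k - i)))
  end.

Definition strong_series (n : nat) : set A := strong_series_rec n n.

Lemma strong_series_rec_indep d e k : k <= d -> k <= e ->
  strong_series_rec d k = strong_series_rec e k.
Proof.
elim: d e k => [|d IH] [|e] k //=.
- by rewrite leqn0 => /eqP->.
- by move=> _; rewrite leqn0 => /eqP->.
move=> kd ke; case: ifP => // _; congr gen_subgroup.
apply: eq_bigcupr => i /= /andP[i1 ik].
have lt_sub : k - i < k by rewrite ltn_subrL i1 (leq_trans _ ik).
by congr (_ \sstar _); apply: IH; rewrite -ltnS;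
  [exact: leq_trans kd|exact: leq_trans ke
  |exact: leq_trans kd|exact: leq_trans ke].
Qed.

Lemma strong_series1 : strong_series 1 = [set: A].
Proof. by []. Qed.

Lemma strong_seriesS n : 1 <= n ->
  strong_series n.+1 = gen_subgroup
    (\bigcup_(i in [set i | 1 <= i <= n])
       (strong_series i \sstar strong_series (n.+1 - i))).
Proof.
move=> n1; rewrite /strong_series [LHS]/= ifN -?ltnNge //; congr gen_subgroup.
apply: eq_bigcupr => i /= /andP[i1 lin].
congr (_ \sstar _); apply: strong_series_rec_indep => //.
by rewrite leq_subLR -addn1 addnC leq_add2r.
Qed.

Definition left_nilpotent : Prop :=
  exists2 n, 1 <= n & left_series n = [set 1].

Definition right_nilpotent : Prop :=
  exists2 n, 1 <= n & right_series n = [set 1].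

Definition strongly_nilpotent : Prop :=
  exists2 n, 1 <= n & strong_series n = [set 1].

End Series.

Arguments star_power : clear implicits.
Arguments left_series : clear implicits.
Arguments right_series : clear implicits.
Arguments strong_series : clear implicits.

(* Main.v *)
Require Import Defs.
From mathcomp Require Import all_boot.
From mathcomp Require Import boolp classical_sets.

(** All three series coincide with the powers [P_n] because the powers multiply
as the powers of an associative ring do: [P_i \sstar P_j = P_(i + j)] for [i, j >= 1]
(lemma [star_powerD]). The recurrences defining the series then become the
recurrence [P_(n + 1) = P_i \sstar P_(n + 1 - i)], for [i = 1], for [i = n],
and for all [i] at once.

Associativity turns a product of [i + j] factors into one product of [i]
factors starred with one of [j] factors, and conversely. The difficulty is that
elements of [P_i] are dot products of such star products, and that the star
product distributes over the dot product only up to conjugation: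
- [a \star (b * c) = (a \star b) * (a \star c) ^ b^-1] in any skew brace;
- [(a * b) \star c = (a \star c) ^ b * (b \star c)] in a two-sided one.
Hence [x \star y] can be reduced to generators as soon as every [P_n] is normal
in the dot group (lemma [star_power_normal]). That follows from the first law
itself: solved for the conjugate, it expresses a conjugate of [u \star d],
with [u] a product of [n - 1] factors, as a quotient of two elements
[u \star _], both again products of [n] factors. *)

Set Implicit Arguments.
Unset Strict Implicit.
Unset Printing Implicit Defensive.

Section GeneratedSubgroup.
Local Open Scope classical_set_scope.
Local Open Scope group_scope.

Lemma group_closed_setP (G : groupType) (H : set G) :
  group_closed (mem H) <-> H 1 /\ (forall x y, H x -> H y -> H (x / y)).
Proof.
split=> -[H1 HB]; split.
- exact: set_mem H1.
- by move=> x y Hx Hy; apply: set_mem; apply: HB; apply: mem_set.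
- exact: mem_set.
- by move=> x y /set_mem Hx /set_mem Hy; apply: mem_set; apply: HB.
Qed.

Variables (G : groupType) (X : set G).

Lemma gen_subgroup1 : gen_subgroup X 1.
Proof. by move=> H [/group_closed_setP[]]. Qed.

Lemma gen_subgroupB x y :
  gen_subgroup X x -> gen_subgroup X y -> gen_subgroup X (x / y).
Proof.
move=> Xx Xy H HX; have [/group_closed_setP[_ HB] _] := HX.
exact: HB (Xx _ HX) (Xy _ HX).
Qed.

Lemma gen_subgroupV x : gen_subgroup X x -> gen_subgroup X x^-1.
Proof. by move=> Xx; rewrite -div1g; apply: gen_subgroupB gen_subgroup1 Xx. Qed.

Lemma gen_subgroupM x y :
  gen_subgroup X x -> gen_subgroup X y -> gen_subgroup X (x * y).
Proof.
by move=> Xx Xy; rewrite -[y]invgK; apply: gen_subgroupB Xx (gen_subgroupV Xy).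
Qed.

Lemma gen_subgroup_min (H : set G) :
  H 1 -> (forall x y, H x -> H y -> H (x / y)) -> X `<=` H ->
  gen_subgroup X `<=` H.
Proof.
move=> H1 HB.
apply: (smallest_sub (C := fun H : set G => group_closed (mem H))).
exact: (proj2 (group_closed_setP H)).
Qed.

Lemma gen_subgroup_normal :
    (forall x g, X x -> gen_subgroup X (x ^ g)) ->
  forall x g, gen_subgroup X x -> gen_subgroup X (x ^ g).
Proof.
move=> XJ x g; move: x.
apply: (gen_subgroup_min (H := [set x | gen_subgroup X (x ^ g)])).
- by rewrite /= conj1g; apply: gen_subgroup1.
- by move=> x y /= Xx Xy; rewrite conjMg conjVg; apply: gen_subgroupB.
- by move=> x Xx; apply: XJ.
Qed.

End GeneratedSubgroup.

Section StarPowers.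
Local Open Scope classical_set_scope.
Local Open Scope group_scope.

Variable A : skewBraceType.
Implicit Types a b c x y : A.

Lemma starMr a b c : a \star (b * c) = (a \star b) * (a \star c) ^ b^-1.
Proof. by rewrite /star /conjg bulMr !gnorm. Qed.

Lemma starx1 a : a \star 1 = 1.
Proof. by rewrite /star bulx1 !gnorm. Qed.

Lemma star1x a : 1 \star a = 1.
Proof. by rewrite /star bul1x !gnorm. Qed.

Hypothesis two_sidedA : two_sided A.
Hypothesis starA : associative (@star A).

Lemma starMl a b c : (a * b) \star c = (a \star c) ^ b * (b \star c).
Proof. by rewrite /star /conjg two_sidedA !gnorm. Qed.

Lemma starVr a b : a \star b^-1 = ((a \star b) ^ b)^-1.
Proof.
apply/eqP; rewrite -mulg_eq1; apply/eqP.
by rewrite -[in X in _ ^ X](invgK b) -starMr mulVg starx1.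
Qed.

Lemma starVl a b : a^-1 \star b = ((a \star b) ^ a^-1)^-1.
Proof. by apply/esym/mulg1_eq; rewrite -starMl mulgV star1x. Qed.

Lemma foldl_star_cat a s b t :
  foldl (@star A) a s \star foldl (@star A) b t
    = foldl (@star A) a (s ++ b :: t).
Proof.
rewrite foldl_cat /=; elim: t b => //= c t IHt b.
by rewrite IHt /= starA.
Qed.

(** Indexed by the number of factors after the first, as products of zero
    factors do not exist. *)
Definition star_words n : set A :=
  [set x | exists a s, size s = n /\ x = foldl (@star A) a s].

(** This also covers the first power, whose definition does not mention
    generators. *)
Lemma star_power_gen n : star_power A n.+1 = gen_subgroup (star_words n).
Proof.
case: n => [|n].
  rewrite eqEsubset; split=> // x _.
  by apply: sub_gen_smallest; exists x, [::].
congr gen_subgroup; rewrite eqEsubset; split.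
  move=> _ [a _] [s _ <-].
  by exists a, s; rewrite size_tuple.
by move=> _ [a [s [sz ->]]]; exists a => //; exists (Tuple (introT eqP sz)).
Qed.

(** The last factor of a word absorbs a conjugation: distributivity over
    [g^-1 * d] gives
    [(u \star d) ^ g = (u \star g^-1)^-1 * (u \star (g^-1 * d))]. *)
Lemma star_power_normal n x g : star_power A n x -> star_power A n (x ^ g).
Proof.
case: n => [|[|n]] //; rewrite star_power_gen; apply: gen_subgroup_normal.
move=> {}x {}g [a [s [sz ->]]]; case/lastP: s sz => // s d.
rewrite size_rcons => -[sz].
have wordP e : star_words n.+1 (foldl (@star A) a s \star e).
  by exists a, (rcons s e); rewrite size_rcons sz foldl_rcons.
rewrite foldl_rcons; set u := foldl _ _ _ in wordP *.
have -> : (u \star d) ^ g = (u \star g^-1)^-1 * (u \star (g^-1 * d)).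
  by rewrite starMr invgK mulKg.
apply: gen_subgroupM; first apply: gen_subgroupV.
  exact: sub_gen_smallest (wordP _).
exact: sub_gen_smallest (wordP _).
Qed.

Lemma star_powerB n x y :
  star_power A n x -> star_power A n y -> star_power A n (x / y).
Proof. by case: n => // n; rewrite star_power_gen; apply: gen_subgroupB. Qed.

Lemma star_powerM n x y :
  star_power A n x -> star_power A n y -> star_power A n (x * y).
Proof. by case: n => // n; rewrite star_power_gen; apply: gen_subgroupM. Qed.

Lemma star_powerV n x : star_power A n x -> star_power A n x^-1.
Proof. by case: n => // n; rewrite star_power_gen; apply: gen_subgroupV. Qed.

Lemma star_power1 n : star_power A n 1.
Proof. by case: n => // n; rewrite star_power_gen; apply: gen_subgroup1. Qed.

(** For a fixed factor, the elements whose star product with it lies in a given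
    power form a subgroup, by normality of that power; it is then enough to
    treat words, first on the right and then on the left. *)
Lemma star_power_star i j x y :
  star_power A i.+1 x -> star_power A j.+1 y ->
  star_power A (i.+1 + j.+1) (x \star y).
Proof.
move=> Px Py; move def_n: (i.+1 + j.+1)%N => n.
have word_word a s b t : size s = i -> size t = j ->
    star_power A n (foldl (@star A) a s \star foldl (@star A) b t).
  move=> sz_s sz_t; rewrite foldl_star_cat -def_n addSn star_power_gen.
  apply: sub_gen_smallest; exists a, (s ++ b :: t).
  by rewrite size_cat /= sz_s sz_t.
have word_power a s : size s = i ->
    star_power A n (foldl (@star A) a s \star y).
  move=> sz_s; move: y Py; rewrite star_power_gen.
  apply: (gen_subgroup_min
    (H := [set y | star_power A n (foldl (@star A) a s \star y)])).
  - by rewrite /= starx1; apply: star_power1.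
  - move=> y z /= Py Pz; rewrite starMr starVr.
    apply: star_powerM Py _; apply: star_power_normal.
    by apply: star_powerV; apply: star_power_normal.
  - by move=> _ [b [t [sz_t ->]]]; apply: word_word.
move: x Px; rewrite star_power_gen.
apply: (gen_subgroup_min (H := [set x | star_power A n (x \star y)])).
- by rewrite /= star1x; apply: star_power1.
- move=> x z /= Px Pz; rewrite starMl starVl.
  apply: star_powerM; first exact: star_power_normal.
  by apply: star_powerV; apply: star_power_normal.
- by move=> _ [a [s [sz_s ->]]]; apply: word_power.
Qed.

Lemma star_powerD i j : 0 < i -> 0 < j ->
  star_power A i \sstar star_power A j = star_power A (i + j).
Proof.
case: i => // i; case: j => // j _ _; rewrite eqEsubset; split.
  apply: gen_subgroup_min; [exact: star_power1|exact: star_powerB|].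
  by move=> _ [x Px] [y Py <-]; apply: star_power_star.
rewrite addSn (star_power_gen (i + j.+1)).
apply: gen_subgroup_min; [exact: gen_subgroup1|exact: gen_subgroupB|].
move=> _ [a [s [sz ->]]]; apply: sub_gen_smallest.
(* The head [a] is kept apart, so the first [i.+1] factors are [a] and the
   first [i] entries of [s]. *)
have : size (drop i s) = j.+1 by rewrite size_drop sz addKn.
case eq_drop: (drop i s) => [|b t] // [sz_t].
rewrite -(cat_take_drop i s) eq_drop -foldl_star_cat.
exists (foldl (@star A) a (take i s)).
  rewrite star_power_gen; apply: sub_gen_smallest; exists a, (take i s).
  by rewrite size_takel // sz leq_addr.
exists (foldl (@star A) b t) => //.
by rewrite star_power_gen; apply: sub_gen_smallest; exists b, t.
Qed.

Lemma left_series_power n : 0 < n -> left_series A n = star_power A n.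
Proof.
elim: n => // -[|n] IHn _ //.
rewrite -[left_series A _]/([set: A] \sstar left_series A n.+1) IHn //.
by rewrite -[[set: A]]/(star_power A 1) star_powerD.
Qed.

Lemma right_series_power n : 0 < n -> right_series A n = star_power A n.
Proof.
elim: n => // -[|n] IHn _ //.
rewrite -[right_series A _]/(right_series A n.+1 \sstar [set: A]) IHn //.
by rewrite -[[set: A]]/(star_power A 1) star_powerD // addn1.
Qed.

Lemma strong_series_power n : 0 < n -> strong_series A n = star_power A n.
Proof.
elim/ltn_ind: n => -[|[|n]] // IHn _; rewrite strong_seriesS //.
have termE i : 0 < i <= n.+1 ->
    strong_series A i \sstar strong_series A (n.+2 - i) = star_power A n.+2.
  move=> /andP[i_gt0 le_in]; have lt_in : i < n.+2 by [].
  have sub_gt0 : 0 < n.+2 - i by rewrite subn_gt0.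
  rewrite !IHn ?ltn_subrL ?i_gt0 // star_powerD //.
  by rewrite subnKC // ltnW.
rewrite eqEsubset; split.
  apply: gen_subgroup_min; [exact: star_power1|exact: star_powerB|].
  by move=> x [i /= /termE ->].
move=> x Px; apply: sub_gen_smallest; exists 1%N => //.
by rewrite termE.
Qed.

End StarPowers.

Theorem mainTheorem7 (A : skewBraceType)
    (two_sidedA : two_sided A) (starA : associative (@star A)) :
  (forall n : nat, 1 <= n ->
     [/\ left_series A n = right_series A n,
         right_series A n = strong_series A n
       & strong_series A n = star_power A n]) /\
  ((left_nilpotent A <-> right_nilpotent A) /\
   (right_nilpotent A <-> strongly_nilpotent A)).
Proof.
have LP := left_series_power two_sidedA starA.
have QP := right_series_power two_sidedA starA.
have SP := strong_series_power two_sidedA starA.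
split; first by move=> n n_gt0; rewrite LP // QP // SP.
by do 2!split; case=> n n_gt0 nil_n; exists n => //;
  rewrite -nil_n ?LP ?QP ?SP.
Qed.
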